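(* Let $F$ be a graph with chromatic number $\chi(F)\geq 3$. Then $$\mathrm{ex}_q(n,F)=\left(1-\frac{1}{\chi(F)-1}+o(1)\right)2n \quad\text{as } n\to\infty.$$
   Context: All graphs are finite and simple. For a graph $G$, its signless Laplacian matrix is $Q(G)=D(G)+A(G)$, where $D(G)$ is the diagonal matrix of vertex degrees and $A(G)$ is the adjacency matrix; $q(G)$ denotes the largest eigenvalue of $Q(G)$ (the signless Laplacian spectral radius). A graph is $F$-free if it contains no subgraph isomorphic to $F$. Define $\mathrm{ex}_q(n,F)=\max\{q(G): G \text{ has } n \text{ vertices and is } F\text{-free}\}$. Here $F$ is fixed and $o(1)$ denotes a quantity tending to $0$ as $n\to\infty$. *)

(* Defs.v *)
From HB Require Import structures.
From mathcomp Require Import all_boot all_order all_algebra.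
From mathcomp Require complex spectral polyrcf.
From mathcomp Require Import all_classical all_reals all_analysis.

Set Implicit Arguments.
Unset Strict Implicit.
Unset Printing Implicit Defensive.

Import Order.TTheory GRing.Theory Num.Theory.
Import numFieldNormedType.Exports.

Local Open Scope classical_set_scope.
Local Open Scope ring_scope.

Record sgraph := SGraph {
  vertex :> finType;
  adj : rel vertex;
  adj_sym : symmetric adj;
  adj_irrefl : irreflexive adj }.

Definition colorable (G : sgraph) (k : nat) : bool :=
  [exists c : {ffun G -> 'I_k},
    [forall x, forall y, adj x y ==> (c x != c y)]].

Lemma colorable_card (G : sgraph) : exists k, colorable G k.
Proof.
exists #|G|; apply/existsP; exists [ffun x => enum_rank x].
apply/forallP => x; apply/forallP => y; apply/implyP => xy.
rewrite !ffunE; apply: contraTneq xy => /enum_rank_inj ->.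
by rewrite adj_irrefl.
Qed.

Definition chromatic_number (G : sgraph) : nat := ex_minn (colorable_card G).

(* Subgraphs need not be induced: non-edges of F are unconstrained. *)
Definition contains_copy (F G : sgraph) : Prop :=
  exists f : F -> G, injective f /\ forall x y, adj x y -> adj (f x) (f y).

Definition F_free (F G : sgraph) : Prop := ~ contains_copy F G.

Definition degree (G : sgraph) (x : G) : nat := #|[set y | adj x y]%SET|.

Section Spectrum.
Variables (R : realType) (G : sgraph).

(* Vertices are indexed through enum_val : 'I_#|G| -> G. *)
Definition degree_mx : 'M[R]_#|G| :=
  diag_mx (\row_i (degree (enum_val i))%:R).

Definition adjacency_mx : 'M[R]_#|G| :=
  \matrix_(i, j) (adj (enum_val i) (enum_val j))%:R.

Definition signless_laplacian : 'M[R]_#|G| := degree_mx + adjacency_mx.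

(* The sup is a maximum as soon as G has a vertex: see q_radiusP. *)
Definition q_radius : R := sup [set a | eigenvalue signless_laplacian a].

End Spectrum.

(* The sup is a maximum for every F with an edge, the case of interest:
   see ex_qP. *)
Definition ex_q (R : realType) (n : nat) (F : sgraph) : R :=
  sup [set x : R | exists G : sgraph,
    [/\ #|G| = n, F_free F G & x = q_radius R G]].

Lemma sup_finite_max (R : realType) (A : set R) :
  finite_set A -> A !=set0 -> A (sup A) /\ ubound A (sup A).
Proof.
move=> /finite_seqP[s ->{A}] [x0 /= x0s].
have [m ms mub] : exists2 m, m \in s & forall y, y \in s -> y <= m.
  elim: s x0 x0s => // a [|b s] IH x0 _.
    by exists a; rewrite ?mem_head// => y; rewrite inE => /eqP ->.
  have [m ms mub] := IH b (mem_head _ _).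
  exists (Num.max a m).
    by rewrite /Num.max; case: ifP => _; rewrite inE ?ms ?orbT ?eqxx.
  move=> y; rewrite inE => /orP[/eqP ->|/mub ym]; rewrite le_max ?lexx//.
  by rewrite ym orbT.
suff -> : sup [set` s] = m by [].
apply/le_anti/andP; split; first by apply: ge_sup => //; exists m.
by apply: ub_le_sup => //; exists m.
Qed.

Lemma signless_laplacian_sym (R : realType) (G : sgraph) :
  (signless_laplacian R G)^T = signless_laplacian R G.
Proof.
rewrite /signless_laplacian linearD /= tr_diag_mx; congr (_ + _).
by apply/matrixP => i j; rewrite !mxE adj_sym.
Qed.

Section SymmetricEigenvalue.
Import complex spectral.
Local Open Scope complex_scope.

Lemma sym_mx_eigenvalue (R : realType) (n : nat) (A : 'M[R]_n) :
  (0 < n)%N -> A^T = A -> exists a, eigenvalue A a.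
Proof.
move=> n0 At; pose f := real_complex R.
have [z zA] := @eigenvalue_closed (R[i]) n (map_mx f A) n0.
suff [x zx] : exists x, z = f x.
  by exists x; move: zA; rewrite zx eigenvalue_map.
have [v vA v0] := eigenvalueP zA.
pose w := (map_mx Num.conj v)^T.
have wA : map_mx f A *m w = z^* *: w.
  have Af : map_mx Num.conj (map_mx f A) = map_mx f A.
    apply/matrixP => i j; rewrite !mxE; apply/CrealP.
    by rewrite complex_real.
  have Aft : (map_mx f A)^T = map_mx f A by rewrite map_trmx At.
  have := congr1 (fun M => (map_mx Num.conj M)^T) vA.
  by rewrite map_mxM trmx_mul Af Aft map_mxZ linearZ.
have e : z *: (v *m w) = z^* *: (v *m w).
  by rewrite scalemxAl -vA -mulmxA wA -scalemxAr.
have vw0 : (v *m w) 0 0 != 0.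
  rewrite mxE; under eq_bigr do rewrite !mxE -normCK.
  rewrite psumr_neq0; last by move=> i _; exact: exprn_ge0.
  have [j vj] := rV0Pn _ v0.
  by apply/hasP; exists j; rewrite ?mem_index_enum //= exprn_gt0 // normr_gt0.
have zz : z^* = z.
  move/matrixP: e => /(_ 0 0); rewrite !mxE => /esym.
  by move/(mulIf _); apply; move: vw0; rewrite mxE.
have /complex_realP[x ->] : z \is Num.real by apply/CrealP.
by exists x.
Qed.

End SymmetricEigenvalue.

Lemma q_radiusP (R : realType) (G : sgraph) : (0 < #|G|)%N ->
  eigenvalue (signless_laplacian R G) (q_radius R G) /\
  forall a, eigenvalue (signless_laplacian R G) a -> a <= q_radius R G.
Proof.
move=> G0; apply: sup_finite_max; last first.
  exact: sym_mx_eigenvalue G0 (signless_laplacian_sym R G).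
set p := char_poly (signless_laplacian R G).
have p0 : p != 0 by apply/monic_neq0/char_poly_monic.
apply: (@sub_finite_set _ _ [set` polyrcf.rootsR p]); last exact: finite_seq.
move=> x; rewrite /= eigenvalue_root_char -/p => px.
by rewrite -(polyrcf.roots_on_rootsR p0) in_itv.
Qed.

Definition edgeless (n : nat) : sgraph :=
  @SGraph 'I_n (fun _ _ => false) (fun _ _ => erefl) (fun _ => erefl).

Lemma edgeless_F_free (F : sgraph) (n : nat) :
  (2 <= chromatic_number F)%N -> F_free F (edgeless n).
Proof.
rewrite /chromatic_number; case: ex_minnP => k _ kmin k2 [f [_ fadj]].
suff /kmin : colorable F 1 by rewrite leqNgt k2.
apply/existsP; exists [ffun=> ord0].
apply/forallP => x; apply/forallP => y; apply/implyP.
by move=> /fadj.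
Qed.

Lemma ex_qP (R : realType) (n : nat) (F : sgraph) :
  (2 <= chromatic_number F)%N ->
  (exists G : sgraph, [/\ #|G| = n, F_free F G & ex_q R n F = q_radius R G]) /\
  forall G : sgraph, #|G| = n -> F_free F G -> q_radius R G <= ex_q R n F.
Proof.
move=> F2; pose A := [set x : R | exists G : sgraph,
  [/\ #|G| = n, F_free F G & x = q_radius R G]].
have [] : A (sup A) /\ ubound A (sup A); last first.
  by move=> Amax Aub; split=> // G Gn GF; apply: Aub; exists G.
apply: sup_finite_max; last first.
  exists (q_radius R (edgeless n)), (edgeless n).
  by split; rewrite ?card_ord //; exact: edgeless_F_free.
pose h m (M : 'M[bool]_m) : R := sup [set a | eigenvalue
  (diag_mx (\row_i (\sum_j (M i j : nat))%:R) + \matrix_(i, j) (M i j)%:R) a].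
apply: (@sub_finite_set _ _ (range (@h n))); last exact: finite_image.
move=> _ [G [<- _ ->]].
exists (\matrix_(i, j) adj (enum_val i) (enum_val j)) => //.
rewrite /h /q_radius /signless_laplacian; congr (sup [set a | eigenvalue _ a]).
apply: funext => _; congr (_ + _); last by apply/matrixP => i j; rewrite !mxE.
congr diag_mx; apply/rowP => i; rewrite !mxE; congr _%:R.
rewrite /degree -[RHS]sum1_card [RHS]big_mkcond /=.
rewrite [RHS](reindex (@enum_val G predT)) /=; last first.
  by apply: onW_bij; exact: enum_val_bij.
by apply: eq_bigr => j _; rewrite inE mxE; case: adj.
Qed.

(* Main.v *)
(* Put r = chi(F) - 1. The Turan graphs give the lower bound. For the upper
   bound let G be F-free with q(G) >= (2(1 - 1/r) + e) n. If x is a unit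
   eigenvector of an induced subgraph G[S] for q(G[S]), deleting a vertex that
   minimises x_w^2 shows that q(G[S])/|S| increases by at least (e^2/8)/|S| as
   long as some vertex has degree at most (1 - 1/r + e/4)|S|. Hence a nonempty S
   maximising q(G[S])/|S| + (e^2/8) H_|S|, with H the harmonic numbers, induces
   a graph of minimum degree larger than that; and |S| tends to infinity with
   |G| because q(G[S])/|S| is bounded by 2 and the harmonic series diverges.
   The minimum degree form of the Erdos-Stone theorem then provides a complete
   (r+1)-partite subgraph with parts of size |F|, which contains F. *)
Require Import Defs.
From HB Require Import structures.
From mathcomp Require Import all_boot all_order all_algebra.
From mathcomp Require complex sesquilinear spectral.
From mathcomp Require Import zify ring lra.
From mathcomp Require Import all_classical all_reals all_analysis.
Import Order.TTheory GRing.Theory Num.Theory.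
Import numFieldNormedType.Exports.

Set Implicit Arguments.
Unset Strict Implicit.
Unset Printing Implicit Defensive.

(** * The minimum degree form of the Erdos-Stone theorem *)

(* Disjointness of the parts need not be required: adjacency is irreflexive. *)
Definition multipartite (G : sgraph) (r t : nat) (B : nat -> {set G}) : Prop :=
  (forall i, i < r -> #|B i| = t) /\
  (forall i j x y, i < r -> j < r -> i != j -> x \in B i -> y \in B j ->
    adj x y).

Lemma exists_subset_card (T : finType) (A : {set T}) (t : nat) :
  t <= #|A| -> exists2 A' : {set T}, A' \subset A & #|A'| = t.
Proof.
move=> /card_geqP[s [us <- sA]]; exists [set x in s].
  by apply/fintype.subsetP => x; rewrite inE => /sA.
by rewrite cardsE (card_uniqP us).
Qed.

Lemma multipartite_subset (G : sgraph) (r t : nat) (B : nat -> {set G}) :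
  (forall i, i < r -> t <= #|B i|) ->
  (forall i j x y, i < r -> j < r -> i != j -> x \in B i -> y \in B j ->
    adj x y) ->
  exists B' : nat -> {set G}, multipartite r t B'.
Proof.
move=> Bt Badj.
have /choice [B' B'P] : forall i, exists A : {set G},
    i < r -> A \subset B i /\ #|A| = t.
  move=> i; case: (ltnP i r) => [ir|]; last by exists finset.set0.
  by have [A AB At] := exists_subset_card (Bt i ir); exists A.
exists B'; split => [i /B'P[]//|i j x y ir jr ij xi yj].
have [/fintype.subsetP iB _] := B'P i ir.
have [/fintype.subsetP jB _] := B'P j jr.
exact: (Badj i j x y ir jr ij (iB _ xi) (jB _ yj)).
Qed.

(** A vertex of F goes into the part of its colour, at the position given by its rank in F. Ranks
    separate vertices that share a part; irreflexivity of adjacency separates vertices of different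
    colours. *)
Lemma contains_copy_multipartite (F G : sgraph) (r : nat)
    (B : nat -> {set G}) :
  colorable F r -> multipartite r #|F| B -> contains_copy F G.
Proof.
move=> /existsP[c /forallP cP] [Bt Badj].
have cardB x : #|B (c x)| = #|F| by apply: Bt.
pose f x := enum_val (cast_ord (esym (cardB x)) (enum_rank x)).
have fB x : f x \in B (c x) by exact: enum_valP.
have fadj x y : c x != c y -> adj (f x) (f y).
  by move=> cxy; apply: (Badj (c x) (c y)).
exists f; split => [x y fxy|x y xy]; last first.
  by apply: fadj; have /forallP/(_ y)/implyP := cP x; apply.
have [cxy|/fadj] := eqVneq (c x) (c y); last by rewrite fxy adj_irrefl.
move: fxy; rewrite /f; move: (cardB x) (cardB y); rewrite cxy => e1 e2.
by move=> /enum_val_inj/(congr1 val)/=/ord_inj/enum_rank_inj.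
Qed.

(* A vertex counts among its own non-neighbours. *)
Definition codegree (G : sgraph) (x : G) : nat := #|[set y | ~~ adj x y]|.

Lemma card_pigeonhole (T U : finType) (W : {set T}) (D : {set U}) (h : T -> U)
    (t : nat) : (forall w, w \in W -> h w \in D) -> #|D| * t < #|W| ->
  exists Y, t <= #|[set w in W | h w == Y]|.
Proof.
move=> hD; rewrite ltnNge => DW; apply/existsP; apply: contraNT DW.
rewrite negb_exists => /forallP Yt.
rewrite -sum1_card (partition_big h (mem D)) //= -sum_nat_const.
apply: leq_sum => Y _; have := Yt Y; rewrite -ltnNge => /ltnW.
by rewrite -sum1dep_card.
Qed.

(* In a graph on g vertices, c counts the non-edges to the parts of size 2mt, and
   all but w vertices miss at least 2mt - t vertices of some part. *)
Lemma card_ge_of_nonedge_count (m t g w c : nat) : 0 < m -> 0 < t -> w <= g ->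
  (g - w) * (2 * m * t - t) <= c -> c * m <= 2 * m * t * (m * g - g) ->
  g <= (2 * m).-1 * w.
Proof.
case: m => // k _ t0 /subnKC <-; set d := g - w; rewrite addKn.
have -> : 2 * k.+1 * t - t = (2 * k).+1 * t.
  by rewrite -[X in _ - X]mul1n -mulnBl; congr (_ * _); lia.
have -> : k.+1 * (w + d) - (w + d) = k * (w + d) by rewrite mulSn addKn.
have -> : (2 * k.+1).-1 = (2 * k).+1 by lia.
move=> lo up.
(* Cancelling t(k+1) leaves d(2k+1) <= 2k(w+d), that is d <= 2kw, and so w + d <= (2k+1)w. *)
have : d * (2 * k).+1 * (t * k.+1) <= 2 * k * (w + d) * (t * k.+1).
  have e1 : d * (2 * k).+1 * (t * k.+1) = d * ((2 * k).+1 * t) * k.+1 by ring.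
  have e2 : 2 * k * (w + d) * (t * k.+1) = 2 * k.+1 * t * (k * (w + d)) by ring.
  by rewrite e1 e2; apply: leq_trans up; rewrite leq_mul2r lo orbT.
rewrite leq_pmul2r ?muln_gt0 ?t0 //.
have -> : d * (2 * k).+1 = d + 2 * (k * d) by ring.
have -> : 2 * k * (w + d) = 2 * (k * w) + 2 * (k * d) by ring.
have -> : (2 * k).+1 * w = w + 2 * (k * w) by ring.
by rewrite leq_add2r => dk; rewrite leq_add2l.
Qed.

(* Many vertices have t neighbours in every part; by pigeonhole, t of them have
   the same neighbours in the union of the parts, and form the new part. *)
Lemma multipartite_extend (G : sgraph) (m r t : nat) (B : nat -> {set G}) :
  0 < m -> 0 < t -> multipartite r (2 * m * t) B ->
  (forall x : G, r * codegree x * m + #|G| <= m * #|G|) ->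
  2 ^ (r * (2 * m * t)) * t * (2 * m) < #|G| ->
  exists B' : nat -> {set G}, multipartite r.+1 t B'.
Proof.
move=> m0 t0 [Bt Badj] Gdeg Glarge; set s := 2 * m * t in Bt Glarge.
pose W := [set w : G | [forall i : 'I_r, t <= #|[set y in B i | adj w y]|]].
have Wcard : #|G| <= (2 * m).-1 * #|W|.
  (* Double counting of the non-edges between G and one part. *)
  have codegB i : i < r ->
      \sum_(b in B i) codegree b = \sum_(w : G) #|[set y in B i | ~~ adj w y]|.
    move=> ir; under eq_bigr do rewrite /codegree -sum1dep_card.
    under [RHS]eq_bigr do rewrite -sum1dep_card.
    rewrite (exchange_big_dep predT) //=; apply: eq_bigr => w _.
    by apply: eq_bigl => b; rewrite adj_sym.
  have nW w : w \notin W ->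
      s - t <= \sum_(i < r) #|[set y in B i | ~~ adj w y]|.
    rewrite inE negb_forall => /existsP[i].
    rewrite -ltnNge => wi; apply: (@leq_trans #|[set y in B i | ~~ adj w y]|).
      rewrite -(Bt i (ltn_ord i)) leq_subLR.
      rewrite -(cardsID [set y | adj w y] (B i)).
      apply: leq_add; first by rewrite -setIdE; apply: ltnW.
      by apply: subset_leq_card; apply/fintype.subsetP => y; rewrite !inE andbC.
    by rewrite (bigD1 i) //= leq_addr.
  have lo : (#|G| - #|W|) * (s - t) <=
      \sum_(i < r) \sum_(b in B i) codegree b.
    under eq_bigr do rewrite codegB //.
    have -> : #|G| - #|W| = #|~: W| by rewrite [RHS]cardsCs finset.setCK.
    rewrite exchange_big /= -sum_nat_const.
    rewrite [X in _ <= X](bigID (mem (~: W))) /=.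
    apply: leq_trans (leq_addr _ _); apply: leq_sum => w.
    by rewrite inE => /nW.
  have up : (\sum_(i < r) \sum_(b in B i) codegree b) * m <=
      s * (m * #|G| - #|G|).
    case: (posnP r) => [r0|r0]; first by rewrite r0 big_ord0.
    have codegm (b : G) : codegree b * (r * m) <= m * #|G| - #|G|.
      by have := Gdeg b; rewrite leq_subRL ?leq_pmull // addnC mulnCA mulnA.
    rewrite -(leq_pmul2l r0) mulnCA big_distrl /=.
    have -> : r * (s * (m * #|G| - #|G|)) =
        \sum_(i < r) s * (m * #|G| - #|G|) by rewrite sum_nat_const card_ord.
    apply: leq_sum => i _.
    rewrite big_distrl /= -(Bt i (ltn_ord i)) -sum_nat_const.
    by apply: leq_sum => b _; apply: codegm.
  have WG : #|W| <= #|G| by exact: max_card.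
  exact: (card_ge_of_nonedge_count m0 t0 WG lo up).
pose U := \bigcup_(i < r) B i.
have Ucard : #|U| <= r * s.
  apply: leq_trans (_ : \sum_(i < r) #|B i| <= _).
    rewrite /U; elim/big_ind2: _ => [|A a C c Aa Cc|//].
      by rewrite cards0.
    exact: leq_trans (leq_card_setU _ _) (leq_add Aa Cc).
  by rewrite (eq_bigr (fun=> s)) => [|i _]; rewrite ?sum_nat_const ?card_ord ?Bt.
have [||Y Yt] := @card_pigeonhole _ _ W (powerset U)
    (fun w => [set y in U | adj w y]) t.
- by move=> w _; rewrite inE; apply/fintype.subsetP => y; rewrite inE => /andP[].
- rewrite card_powerset.
  have Us : 2 ^ #|U| <= 2 ^ (r * s) by rewrite leq_exp2l.
  rewrite ltnNge; apply: contraL Glarge => WU; rewrite -leqNgt.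
  apply: (leq_trans Wcard); rewrite mulnC.
  apply: leq_mul (leq_pred _); apply: leq_trans WU _.
  by rewrite leq_mul2r Us orbT.
(* The vertices of [W] with trace [Y] on [U] become the part of index r. Each old part is cut down
   to [Y]; at least t vertices remain, because any such w has t neighbours in that part and they all
   lie in [Y]. *)
apply: (@multipartite_subset _ _ _ (fun i => if i == r
    then [set w in W | [set y in U | adj w y] == Y] else B i :&: Y)).
- move=> i; rewrite ltnS leq_eqVlt; case: eqP => [//|_ /= ir].
  have [w] : exists w, w \in [set w in W | [set y in U | adj w y] == Y].
    by apply/card_gt0P; apply: leq_trans Yt.
  rewrite !inE => /andP[/forallP/(_ (Ordinal ir)) wB /eqP wY].
  apply: leq_trans wB _; apply: subset_leq_card; apply/fintype.subsetP => y.
  rewrite !inE /= -wY inE => /andP[yB ->]; rewrite yB andbT /=.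
  by apply/finset.bigcupP; exists (Ordinal ir).
- have wy w y : w \in [set w in W | [set y in U | adj w y] == Y] ->
      y \in Y -> adj w y.
    by rewrite inE => /andP[_ /eqP <-]; rewrite inE => /andP[].
  move=> i j x y; rewrite !ltnS (leq_eqVlt i) (leq_eqVlt j).
  case: (eqVneq i r) => [->|ir]; case: (eqVneq j r) => [->|jr] //=.
  + by move=> _ _ _ xW /finset.setIP[_]; apply: wy.
  + move=> _ _ _ /finset.setIP[_ xY] yW.
    by rewrite adj_sym; apply: wy.
  + move=> ir' jr' ij /finset.setIP[xi _] /finset.setIP[yj _].
    exact: (Badj i j).
Qed.

(* The degree hypothesis is r (n - deg x) <= (1 - 1/m) n, that is
   deg x >= (1 - 1/r + 1/(rm)) n, cleared of denominators. *)
Lemma min_degree_multipartite (m r t : nat) : 0 < m ->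
  exists N, forall G : sgraph, N < #|G| ->
    (forall x : G, r * codegree x * m + #|G| <= m * #|G|) ->
    exists B : nat -> {set G}, multipartite r.+1 t B.
Proof.
move=> m0; elim: r t => [|r IH] t.
  exists t => G Gt _; apply: (@multipartite_subset _ _ _ (fun=> [set: G]%SET)).
    by move=> i _; rewrite cardsT ltnW.
  by move=> i j x y; rewrite !ltnS !leqn0 => /eqP-> /eqP->.
(* Parts of size t + 1 are built and then trimmed to t, because the extension step requires a
   positive size. *)
have [N NP] := IH (2 * m * t.+1).
exists (N + 2 ^ (r.+1 * (2 * m * t.+1)) * t.+1 * (2 * m)) => G GN Gdeg.
have [||B Bm] := NP G.
- exact: leq_ltn_trans (leq_addr _ _) GN.
- move=> x; apply: leq_trans (Gdeg x); rewrite leq_add2r.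
  by rewrite leq_mul2r leq_mul2r leqnSn !orbT.
have [|B' [Bt Badj]] := multipartite_extend m0 (ltn0Sn t) Bm Gdeg.
  exact: leq_ltn_trans (leq_addl _ _) GN.
by apply: (@multipartite_subset _ _ _ B') => // i /Bt->.
Qed.

Local Open Scope classical_set_scope.
Local Open Scope ring_scope.

(** * Rayleigh quotients and eigenvectors of the signless Laplacian *)

Section Rayleigh.
Import complex sesquilinear spectral.
Local Open Scope complex_scope.
Local Open Scope sesquilinear_scope.

(** Over the complex numbers A is unitarily diagonalisable. With Z the coordinates of y in an
    eigenbasis, the two forms are the sums of d_i |Z_i|^2 and of |Z_i|^2, and each d_i is a real
    eigenvalue of A, hence at most q. *)
Lemma sym_mx_rayleigh (R : realType) (n : nat) (A : 'M[R]_n) (q : R) :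
  A^T = A -> (forall a, eigenvalue A a -> a <= q) ->
  forall y : 'rV_n, (y *m A *m y^T) 0 0 <= q * (y *m y^T) 0 0.
Proof.
move=> At Aq y; pose f := real_complex R.
pose B := map_mx f A; pose P := spectralmx B; pose d := spectral_diag B.
have Breal : B \is a realmx.
  by apply/mxOverP => i j; rewrite mxE complex_real.
have Bherm : B \is hermsymmx.
  apply: realsym_hermsym => //; apply/is_hermitianmxP.
  rewrite expr0 scale1r map_mx_id //. by rewrite /B map_trmx At.
have PB : B = invmx P *m diag_mx d *m P.
  exact/orthomx_spectralP/hermitian_normalmx.
have Pu : P \is unitarymx by exact: spectral_unitarymx.
have Punit : P \in unitmx by exact: unitarymx_unit.
(* Row i of [P] is an eigenvector for d_i, nonzero because [P] is invertible. *)
have dq i : d 0 i <= f q.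
  have di : eigenvalue B (d 0 i).
    apply/eigenvalueP; exists (row i P).
      rewrite -row_mul {1}PB !mulmxA mulmxV // mul1mx.
      by rewrite row_mul row_diag_mx -scalemxAl -rowE.
    apply/eqP => ri0; have := mulmxK Punit (delta_mx 0 i : 'rV_n).
    rewrite -rowE ri0 mul0mx => /rowP/(_ i); rewrite !mxE !eqxx => /eqP.
    by rewrite eq_sym oner_eq0.
  have /complex_realP[a da] : d 0 i \is Num.real.
    by have /mxOverP := hermitian_spectral_diag_real Bherm; apply.
  by rewrite da lecR Aq // -(eigenvalue_map f) -/B; move: di; rewrite da.
pose Y := map_mx f y; pose Z := Y *m P^t*.
have YtE : Y^t* = map_mx f y^T.
  apply/matrixP => i j; by rewrite !mxE; apply/CrealP; rewrite complex_real.
have PtP : P^t* *m P = 1%:M by rewrite -invmx_unitary // mulVmx.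
have Zt : Z^t* = P *m Y^t* by rewrite trmx_mul map_mxM /= trmxCK.
have normZ : map_mx f (y *m y^T) = Z *m Z^t*.
  by rewrite Zt /Z mulmxA -[Y *m _ *m _]mulmxA PtP mulmx1 YtE -map_mxM.
have formZ : map_mx f (y *m A *m y^T) = Z *m diag_mx d *m Z^t*.
  rewrite !map_mxM -/B -YtE -/Y Zt /Z PB invmx_unitary //.
  by rewrite !mulmxA.
rewrite -lecR rmorphM /=.
have -> : ((y *m A *m y^T) 0 0)%:C = \sum_i d 0 i * `|Z 0 i| ^+ 2.
  have /matrixP/(_ 0 0) := formZ; rewrite mxE /f => ->.
  rewrite mul_mx_diag mxE; apply: eq_bigr => i _.
  by rewrite !mxE normCK mulrA [d 0 i * _]mulrC.
have -> : ((y *m y^T) 0 0)%:C = \sum_i `|Z 0 i| ^+ 2.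
  have /matrixP/(_ 0 0) := normZ; rewrite mxE /f => ->.
  by rewrite mxE; apply: eq_bigr => i _; rewrite !mxE normCK.
rewrite mulr_sumr; apply: ler_sum => i _.
by apply: ler_wpM2r (dq i); rewrite exprn_ge0.
Qed.
End Rayleigh.

Lemma sum_enum_val (R : realType) (T : finType) (f : 'I_#|T| -> R) :
  \sum_i f i = \sum_(u : T) f (enum_rank u).
Proof.
rewrite (reindex (@enum_rank T)) //=.
by apply: onW_bij; exact: enum_rank_bij.
Qed.

Lemma mul_signless_laplacian (R : realType) (G : sgraph)
    (v : 'rV[R]_#|G|) (u : G) :
  (v *m signless_laplacian R G) 0 (enum_rank u) =
  \sum_(w | adj u w) (v 0 (enum_rank u) + v 0 (enum_rank w)).
Proof.
rewrite /signless_laplacian mulmxDr mxE big_split /=; congr (_ + _).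
  by rewrite /degree_mx mul_mx_diag !mxE enum_rankK sumr_const mulr_natr
    /degree cardsE.
rewrite mxE sum_enum_val [RHS]big_mkcond; apply: eq_bigr => w _.
by rewrite !mxE !enum_rankK adj_sym; case: adj; rewrite ?mulr1 ?mulr0.
Qed.

(** The left side is the quadratic form of Q(G) at y, kept as a sum over ordered pairs so that it
    can be split vertex by vertex. *)
Lemma q_rayleigh (R : realType) (G : sgraph) (y : G -> R) : (0 < #|G|)%N ->
  \sum_u \sum_(v | adj u v) y u * (y u + y v) <=
  q_radius R G * \sum_u y u ^+ 2.
Proof.
move=> G0; have [_ qmax] := q_radiusP R G0.
pose v : 'rV[R]_#|G| := \row_i y (enum_val i).
have vE u : v 0 (enum_rank u) = y u by rewrite mxE enum_rankK.
have -> : \sum_u \sum_(w | adj u w) y u * (y u + y w) =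
    (v *m signless_laplacian R G *m v^T) 0 0.
  rewrite mxE sum_enum_val; apply: eq_bigr => u _.
  rewrite mul_signless_laplacian [v^T _ _]mxE vE mulrC mulr_sumr.
  by apply: eq_bigr => w _; rewrite vE.
have -> : \sum_u y u ^+ 2 = (v *m v^T) 0 0.
  rewrite mxE sum_enum_val; apply: eq_bigr => u _.
  by rewrite [v^T _ _]mxE vE expr2.
exact: sym_mx_rayleigh (signless_laplacian_sym R G) qmax v.
Qed.

Lemma q_eigenvector (R : realType) (G : sgraph) : (0 < #|G|)%N ->
  exists x : G -> R, \sum_u x u ^+ 2 = 1 /\
    forall u, \sum_(v | adj u v) (x u + x v) = q_radius R G * x u.
Proof.
move=> G0; have [/eigenvalueP[v vQ v0] _] := q_radiusP R G0.
pose z u := v 0 (enum_rank u).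
pose c := Num.sqrt (\sum_u z u ^+ 2).
have zE u : \sum_(w | adj u w) (z u + z w) = q_radius R G * z u.
  by rewrite -mul_signless_laplacian vQ mxE.
have z2 : 0 < \sum_u z u ^+ 2.
  rewrite lt_def sumr_ge0 ?andbT => [|u _]; last exact: sqr_ge0.
  rewrite psumr_neq0 => [|u _]; last exact: sqr_ge0.
  have /rV0Pn[i vi] := v0; apply/hasP; exists (enum_val i).
    by rewrite mem_index_enum.
  by rewrite /z enum_valK /= exprn_even_gt0.
exists (fun u => z u / c); split=> [|u].
  under eq_bigr do rewrite expr_div_n.
  by rewrite -mulr_suml sqr_sqrtr ?ltW // divff // gt_eqF.
by under eq_bigr do rewrite -mulrDl; rewrite -mulr_suml zE mulrA.
Qed.

(** * Spectra of induced subgraphs *)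

Definition induced_subgraph (G : sgraph) (S : {set G}) : sgraph :=
  @SGraph {x : G | x \in S} (fun x y => adj (val x) (val y))
    (fun x y => adj_sym (val x) (val y)) (fun x => adj_irrefl (val x)).

Section Induced.
Variables (R : realType) (G : sgraph).
Implicit Types (S : {set G}) (x y : G -> R).

Lemma card_induced S : #|induced_subgraph S| = #|S|.
Proof. by rewrite card_sig; apply: eq_card => u; rewrite inE. Qed.

Lemma sum_induced S (f : G -> R) (P : pred G) :
  \sum_(u : induced_subgraph S | P (val u)) f (val u) = \sum_(u in S | P u) f u.
Proof. by rewrite (big_sub_cond (mem S)). Qed.

(** The test vector is a function on all of G, so that an eigenvector for S can be tested unchanged
    on S minus a vertex. *)
Lemma q_rayleigh_induced S y : (0 < #|S|)%N ->
  \sum_(u in S) \sum_(v in S | adj u v) y u * (y u + y v) <=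
  q_radius R (induced_subgraph S) * \sum_(u in S) y u ^+ 2.
Proof.
rewrite -card_induced => S0.
have := q_rayleigh (fun u : induced_subgraph S => y (val u)) S0.
have -> : \sum_(u in S) y u ^+ 2 = \sum_(u : induced_subgraph S) y (val u) ^+ 2.
  by rewrite (sum_induced S (fun u => y u ^+ 2) predT) big_mkcondr.
under eq_bigr => u _.
  rewrite (sum_induced S (fun v => y (val u) * (y (val u) + y v)) (adj (val u))).
  over.
rewrite (sum_induced S (fun u => \sum_(v in S | adj u v) y u * (y u + y v)) predT).
by rewrite big_mkcondr.
Qed.

Lemma q_eigenvector_induced S : (0 < #|S|)%N ->
  exists x : G -> R, \sum_(u in S) x u ^+ 2 = 1 /\
    forall u, u \in S ->
      \sum_(v in S | adj u v) (x u + x v) = q_radius R (induced_subgraph S) * x u.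
Proof.
rewrite -card_induced => S0; have [z [z1 zE]] := q_eigenvector R S0.
(* Extension by 0 outside S; only the values on S enter the conclusion. *)
pose x u : R := if insub u is Some u' then z u' else 0.
have xz (u : induced_subgraph S) : x (val u) = z u by rewrite /x valK.
exists x; split=> [|u uS].
  rewrite -z1 (eq_bigr (fun u => x (val u) ^+ 2)) => [|u _]; last by rewrite xz.
  by rewrite (sum_induced S (fun u => x u ^+ 2) predT) big_mkcondr.
have := zE (Sub u uS); rewrite -xz SubK => <-.
rewrite -(sum_induced S (fun v => x u + x v) (adj u)).
by apply: eq_bigr => v _; rewrite xz.
Qed.

End Induced.

(** * Deleting a vertex where the eigenvector is smallest *)

Lemma sqr_sum_le (R : realType) (T : finType) (P : pred T) (x : T -> R) :
  (\sum_(i | P i) x i) ^+ 2 <= #|P|%:R * \sum_(i | P i) x i ^+ 2.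
Proof.
set X := \sum_(i | P i) x i; set X2 := \sum_(i | P i) x i ^+ 2.
have [P0|P0] := posnP #|P|.
  have P0' := card0_eq P0.
  by rewrite /X big_pred0 // P0 mul0r expr2 mulr0.
(* Expanding these squares and dividing by |P| gives Cauchy-Schwarz. *)
have : 0 <= \sum_(i | P i) (#|P|%:R * x i - X) ^+ 2.
  by apply: sumr_ge0 => i _; exact: sqr_ge0.
under eq_bigr do rewrite sqrrB exprMn.
rewrite big_split /= sumrB sumr_const -mulr_sumr -/X2 sumrMnl.
rewrite -mulr_suml -mulr_sumr -/X -mulr_natl => H.
have P0R : 0 < #|P|%:R :> R by rewrite ltr0n.
by rewrite -(ler_pM2l P0R); lra.
Qed.

Section Deletion.
Variables (R : realType) (G : sgraph) (S : {set G}) (q : R) (x : G -> R).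
Hypothesis x_unit : \sum_(u in S) x u ^+ 2 = 1.
Hypothesis x_eigen : forall u, u \in S ->
  \sum_(v in S | adj u v) (x u + x v) = q * x u.

Let d (u : G) : nat := #|[set v in S | adj u v]%SET|.
Let s (u : G) : R := \sum_(v in S | adj u v) x v ^+ 2.

Lemma eigen_sum_neighbours u : u \in S ->
  \sum_(v in S | adj u v) x v = (q - (d u)%:R) * x u.
Proof.
move=> uS; rewrite mulrBl -x_eigen // big_split /= sumr_const /d cardsE.
by rewrite mulr_natl addrC addrK.
Qed.

(** Each of the |S| - d(u) non-neighbours of u in S, u included, takes at least mu from the total
    weight 1. *)
Lemma sum_neighbours_sqr_le (mu : R) u :
  (forall v, v \in S -> mu <= x v ^+ 2) ->
  s u <= 1 - (#|S|%:R - (d u)%:R) * mu.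
Proof.
move=> mu_le; rewrite -[X in _ <= X - _]x_unit (bigID (adj u)) /= -/(s u).
rewrite -addrA lerDl subr_ge0.
have -> : #|S|%:R - (d u)%:R = #|[set v in S | ~~ adj u v]%SET|%:R :> R.
  rewrite -(cardsID [set v | adj u v]%SET S) natrD -setIdE addrC addKr.
  by congr _%:R; apply: eq_card => v; rewrite !inE andbC.
rewrite mulr_natl -sumr_const.
rewrite [leLHS](eq_bigl (fun v => (v \in S) && ~~ adj u v)) => [|v].
  2: by rewrite inE.
by apply: ler_sum => v /andP[vS _]; exact: mu_le.
Qed.

(** Cauchy-Schwarz applied to the eigenvalue equation at u, combined with the bound on the weight of
    its neighbours. *)
Lemma eigen_min_le (mu : R) u : u \in S ->
  (forall v, v \in S -> mu <= x v ^+ 2) ->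
  (q - (d u)%:R) ^+ 2 * mu <= (d u)%:R * (1 - (#|S|%:R - (d u)%:R) * mu).
Proof.
move=> uS mu_le; apply: le_trans (_ : (q - (d u)%:R) ^+ 2 * x u ^+ 2 <= _).
  by apply: ler_wpM2l (mu_le _ uS); exact: sqr_ge0.
rewrite -exprMn -eigen_sum_neighbours //; apply: le_trans (sqr_sum_le _ _) _.
have -> : #|[pred v | (v \in S) && adj u v]| = d u by rewrite /d cardsE.
by apply: ler_wpM2l => //; exact: sum_neighbours_sqr_le.
Qed.

(** In the quadratic form, x_u x_v is at most the mean of x_u^2 and x_v^2, so q <= 2D, where D
    weights each x_u^2 by the degree of u in S. *)
Lemma eigen_radius_le : q <= 2 * #|S|%:R.
Proof.
have qE : q = \sum_(u in S) \sum_(v in S | adj u v) (x u ^+ 2 + x u * x v).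
  transitivity (\sum_(u in S) q * x u ^+ 2).
    by rewrite -mulr_sumr x_unit mulr1.
  apply: eq_bigr => u uS; rewrite expr2 mulrCA -x_eigen // mulr_sumr.
  by apply: eq_bigr => v _; rewrite mulrDr.
pose D := \sum_(u in S) \sum_(v in S | adj u v) x u ^+ 2.
have DE : \sum_(u in S) \sum_(v in S | adj u v) x v ^+ 2 = D.
  rewrite (exchange_big_dep (mem S)) /=; last by move=> i j _ /andP[].
  apply: eq_bigr => v vS; apply: eq_bigl => u.
  by rewrite vS adj_sym.
have DS : D <= #|S|%:R.
  rewrite -[leRHS]mulr1 -[X in _ <= _ * X]x_unit mulr_sumr.
  apply: ler_sum => u uS; rewrite sumr_const -[leLHS]mulr_natl.
  apply: ler_wpM2r; first exact: sqr_ge0.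
  by rewrite ler_nat; apply: subset_leq_card; apply/fintype.subsetP => v /andP[].
have : q <= D + (D + D) / 2.
  rewrite {1}qE -{3}DE /D -big_split mulr_suml -big_split.
  apply: ler_sum => u uS; rewrite -big_split mulr_suml -big_split.
  apply: ler_sum => v _ /=.
  by have := sqr_ge0 (x u - x v); lra.
by lra.
Qed.

(** From the full form, equal to q, the terms with u = w remove q x_w^2, and those with v = w remove
    [s w] plus x_w times the sum of x over the neighbours of w. *)
Lemma rayleigh_deletion w : w \in S ->
  \sum_(u in S :\ w) \sum_(v in S :\ w | adj u v) x u * (x u + x v) =
  q * (1 - x w ^+ 2) - s w - (q - (d w)%:R) * x w ^+ 2.
Proof.
move=> wS.
have inner u : u \in S :\ w ->
    \sum_(v in S :\ w | adj u v) x u * (x u + x v) =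
    q * x u ^+ 2 - (if adj w u then x u ^+ 2 + x w * x u else 0).
  rewrite !inE => /andP[uw uS].
  have -> : q * x u ^+ 2 = \sum_(v in S | adj u v) x u * (x u + x v).
    by rewrite -mulr_sumr x_eigen // expr2 mulrCA.
  rewrite [in RHS]big_mkcondr (big_setD1 w) //= -big_mkcondr.
  rewrite (adj_sym w u) addrAC; case: ifP => _; last by rewrite subr0 add0r.
  by rewrite mulrDr -expr2 [x u * x w]mulrC subrr add0r.
rewrite (eq_bigr _ inner) sumrB -mulr_sumr -addrA -opprD; congr (_ * _ - _).
  by rewrite -[X in _ = X - _]x_unit [X in _ = X - _](big_setD1 w) //= addrAC
    subrr add0r.
have -> : \sum_(u in S :\ w) (if adj w u then x u ^+ 2 + x w * x u else 0) =
    \sum_(u in S | adj w u) (x u ^+ 2 + x w * x u).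
  by rewrite [RHS]big_mkcondr [RHS](big_setD1 w) //= adj_irrefl add0r.
rewrite big_split /= -mulr_sumr eigen_sum_neighbours //; congr (_ + _).
by rewrite expr2 mulrCA.
Qed.
End Deletion.

(* The case mu = x_w^2, with d the degree of an arbitrary vertex, d' that of w and
   s' the sum of x_v^2 over the neighbours v of w. *)
Lemma deletion_gain (R : realType) (n q q' tau e d d' s' mu : R) :
  0 < e -> e <= 1 -> 1 + e <= tau -> 16 < e ^+ 2 * n -> 0 < n ->
  tau * n <= q -> q <= 2 * n ->
  0 <= d -> d <= (tau / 2 - e / 4) * n -> d <= n ->
  0 <= mu -> n * mu <= 1 ->
  (q - d) ^+ 2 * mu <= d * (1 - (n - d) * mu) ->
  s' <= 1 - (n - d') * mu ->
  q * (1 - mu) - s' - (q - d') * mu <= q' * (1 - mu) ->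
  (n - 1) * (q + e ^+ 2 / 8) < n * q'.
Proof.
move=> e0 e1 etau ne n0 qlo qhi d0 dlo dn mu0 p1 hmin hs hdel.
pose p := n * mu.
have p0 : 0 <= p by rewrite mulr_ge0 // ltW.
(* The smallest squared entry stays clearly below the average 1/n: q >= n and q - 2d >= ne/2 give
   p(1 + e/2) <= 1, and e <= 1 turns this into p <= 1 - e/4. *)
have pe : p <= 1 - e / 4.
  have h1 : p * (q * (q - 2 * d)) <= n * d * (1 - p).
    suff : n * ((q - d) ^+ 2 * mu) <= n * (d * (1 - (n - d) * mu)).
      by rewrite /p; lra.
    by rewrite ler_pM2l.
  have h2 : n * (n * e / 2) <= q * (q - 2 * d).
    by apply: ler_pM; nra.
  have h3 : p * (n * (n * e / 2)) <= n * n * (1 - p).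
    apply: le_trans (ler_wpM2l p0 h2) _; apply: le_trans h1 _.
    by apply: ler_wpM2r; [rewrite subr_ge0|rewrite ler_pM2l].
  have h4 : p * (e / 2) <= 1 - p.
    by rewrite -(@ler_pM2l _ (n * n)) ?mulr_gt0 //; lra.
  by nra.
have n1 : 1 < n by nra.
have mu1 : 0 < 1 - mu.
  by rewrite subr_gt0 -(@ltr_pM2l _ n) // (le_lt_trans p1) // mulr1.
rewrite -(ltr_pM2r mu1) -[X in _ < X]mulrA.
apply: lt_le_trans (_ : n * (q * (1 - mu) - s' - (q - d') * mu) <= _); last first.
  by rewrite ler_pM2l.
have hs' : n * s' <= n - (n - d') * p.
  by have := ler_wpM2l (ltW n0) hs; rewrite /p; lra.
have mup : mu <= 1 by lra.
(* The degree d' has cancelled. The first term is at least e^2 n/4, so after subtracting e^2 n/8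
   what is left must beat the error q mu <= 2: this is the hypothesis 16 < e^2 n. *)
suff : 0 < (1 - p) * (q - n) - e ^+ 2 / 8 * n + e ^+ 2 / 8 * (1 + p)
    - (q + e ^+ 2 / 8) * mu by move: hs'; rewrite /p; lra.
have g1 : e / 4 * (e * n) <= (1 - p) * (q - n) by apply: ler_pM; nra.
have g2 : q * mu <= 2.
  by apply: le_trans (ler_wpM2r mu0 qhi) _; lra.
have g3 : e ^+ 2 / 8 * mu <= e ^+ 2 / 8.
  by rewrite ler_piMr // divr_ge0 // sqr_ge0.
have g4 : 0 <= e ^+ 2 / 8 * p by rewrite mulr_ge0 // divr_ge0 // sqr_ge0.
by lra.
Qed.

Lemma degree_induced (G : sgraph) (S : {set G}) (u : induced_subgraph S) :
  degree u = #|[set v in S | adj (val u) v]%SET|.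
Proof.
rewrite /degree -(card_imset _ val_inj); apply: eq_card => v.
apply/imsetP/idP => [[z zP ->]|]; first by move: zP; rewrite !inE (valP z).
rewrite !inE => /andP[vS uv]; exists (Sub v vS : induced_subgraph S) => //.
by rewrite inE.
Qed.

(** The deleted w minimises x_w^2 and need not be u, which only serves to bound that minimum.
    Divided by |S|(|S| - 1), the conclusion says that q/|S| grows by more than (e^2/8)/|S|. *)
Lemma induced_deletion_gain (R : realType) (G : sgraph) (S : {set G})
    (tau e : R) (u : G) :
  0 < e -> e <= 1 -> 1 + e <= tau -> 16 < e ^+ 2 * #|S|%:R ->
  tau * #|S|%:R <= q_radius R (induced_subgraph S) -> u \in S ->
  #|[set v in S | adj u v]%SET|%:R <= (tau / 2 - e / 4) * #|S|%:R ->
  exists2 w, w \in S &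
    (#|S|%:R - 1) * (q_radius R (induced_subgraph S) + e ^+ 2 / 8) <
    #|S|%:R * q_radius R (induced_subgraph (S :\ w)).
Proof.
move=> e0 e1 etau Slarge qlo uS du.
have S0 : (0 < #|S|)%N by rewrite card_gt0; apply/set0Pn; exists u.
have [x [x1 xE]] := q_eigenvector_induced R S0.
have [w wS wmin] := @arg_minP _ R G u (mem S) (fun v => x v ^+ 2) uS.
have SR0 : 0 < #|S|%:R :> R by rewrite ltr0n.
have SR1 : 1 < #|S|%:R :> R by nra.
exists w => //.
have {}wS : w \in S by exact: wS.
have wmin' v : v \in S -> x w ^+ 2 <= x v ^+ 2 by exact: wmin.
have h1 := eigen_min_le x1 xE uS wmin'.
have h2 := sum_neighbours_sqr_le x1 w wmin'.
have h3 := eigen_radius_le x1 xE.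
apply: (deletion_gain e0 e1 etau Slarge SR0 qlo h3 (ler0n _ _) du _
  (sqr_ge0 _) _ h1 h2).
- rewrite ler_nat; apply: subset_leq_card; apply/fintype.subsetP => v.
  by rewrite inE => /andP[].
- rewrite -[leRHS]x1 mulr_natl -sumr_const; exact: ler_sum.
rewrite -(rayleigh_deletion x1 xE wS).
have -> : 1 - x w ^+ 2 = \sum_(v in S :\ w) x v ^+ 2.
  by rewrite -[X in X - _]x1 (big_setD1 w) //= addrAC subrr add0r.
apply: q_rayleigh_induced.
by move: SR1; rewrite (cardsD1 w) wS ltr1n ltnS.
Qed.

(** * Induced subgraphs of large minimum degree *)

Lemma q_radius_le_setT (R : realType) (G : sgraph) : (0 < #|G|)%N ->
  q_radius R G <= q_radius R (induced_subgraph [set: G]%SET).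
Proof.
move=> G0; have [x [x1 xE]] := q_eigenvector R G0.
have T0 : (0 < #|[set: G]%SET|)%N by rewrite cardsT.
(* The vertex types differ, so the eigenvector of G is used as a test vector instead of transporting
   the matrix. *)
have := q_rayleigh_induced x T0.
rewrite (eq_bigl predT) => [|u]; last by rewrite inE.
rewrite [X in _ * X](eq_bigl predT) => [|u]; last by rewrite inE.
rewrite x1 mulr1; apply: le_trans.
rewrite -[leLHS]mulr1 -[X in _ * X <= _]x1 mulr_sumr.
rewrite le_eqVlt; apply/orP; left; apply/eqP; apply: eq_bigr => u _.
rewrite expr2 mulrCA -xE mulr_sumr; apply: eq_bigl => v.
by rewrite inE.
Qed.

Lemma harmonic_unbounded (R : realType) (A : R) :
  exists N, forall n, (N <= n)%N -> A < series harmonic n.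
Proof.
have mono : nondecreasing_seq (series (@harmonic R)).
  by apply: nondecreasing_series => n _ _; exact: harmonic_ge0.
have [[N NA]|noN] := pselect (exists N, A < series harmonic N).
  by exists N => n Nn; apply: lt_le_trans NA (mono _ _ Nn).
exfalso; apply: (@dvg_harmonic R); apply: nondecreasing_is_cvgn => //.
exists A => _ [n _ <-]; rewrite leNgt; apply/negP => An; apply: noN.
by exists n.
Qed.

Lemma exists_large_min_degree (R : realType) (tau e : R) (N : nat) :
  0 < e -> e <= 1 -> 1 + e <= tau ->
  exists M, forall G : sgraph, (M <= #|G|)%N ->
    tau * #|G|%:R <= q_radius R G ->
    exists S : {set G}, (N < #|S|)%N /\ forall u, u \in S ->
      (tau / 2 - e / 4) * #|S|%:R < #|[set v in S | adj u v]%SET|%:R.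
Proof.
move=> e0 e1 etau; pose g := e ^+ 2 / 8.
have g0 : 0 < g by rewrite divr_gt0 // exprn_gt0.
pose N' := maxn N (Num.truncn (16 / e ^+ 2)).+1.
(* If |S| <= N', the potential of S is at most 2 + g H_N', which is below g H_|G| by this choice of
   [M], against the maximality of S. *)
have [M MP] := harmonic_unbounded (series harmonic N' + 2 / g).
exists (maxn M 1) => G; rewrite geq_max => /andP[MG G0] qlo.
pose h : nat -> R := series harmonic.
pose psi (S : {set G}) := q_radius R (induced_subgraph S) / #|S|%:R + g * h #|S|.
have T0 : (0 < #|[set: G]%SET|)%N by rewrite cardsT.
have [S S0 Smax] := @arg_maxP _ R _ [set: G]%SET
  (fun S : {set G} => (0 < #|S|)%N) psi T0.
have SR0 : 0 < #|S|%:R :> R by rewrite ltr0n.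
have mono : nondecreasing_seq h.
  by apply: nondecreasing_series => n _ _; exact: harmonic_ge0.
have psiT : tau + g * h #|G| <= psi S.
  apply: le_trans (Smax _ T0); rewrite /psi cardsT lerD2r.
  rewrite ler_pdivlMr ?ltr0n //; apply: le_trans qlo _.
  exact: q_radius_le_setT.
have [x [x1 xE]] := q_eigenvector_induced R S0.
have qhi := eigen_radius_le x1 xE.
have SN : (N' < #|S|)%N.
  rewrite ltnNge; apply/negP => /mono hS.
  have q2 : q_radius R (induced_subgraph S) / #|S|%:R <= 2 by rewrite ler_pdivrMr.
  have := MP _ MG; rewrite -/h -(ltr_pM2l g0) mulrDr mulrCA divff ?gt_eqF //.
  have := ler_wpM2l (ltW g0) hS; move: psiT; rewrite /psi; lra.
(* Since H_|S| <= H_|G|, comparison with the whole vertex set shows that S inherits the lower bound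
   on q. *)
have qS : tau * #|S|%:R <= q_radius R (induced_subgraph S).
  rewrite -ler_pdivlMr //.
  have := ler_wpM2l (ltW g0) (mono _ _ (max_card (mem S))).
  by move: psiT; rewrite /psi; lra.
exists S; split=> [|u uS]; first by apply: leq_ltn_trans SN; rewrite leq_maxl.
rewrite ltNge; apply/negP => du.
have Slarge : 16 < e ^+ 2 * #|S|%:R.
  rewrite -ltr_pdivrMl ?exprn_gt0 // mulrC.
  apply: lt_trans (truncnS_gt _) _; rewrite ltr_nat; apply: leq_ltn_trans SN.
  by rewrite leq_maxr.
have [w wS wgain] := induced_deletion_gain e0 e1 etau Slarge qS uS du.
have cS : #|S| = #|S :\ w|.+1 by rewrite (cardsD1 w) wS.
have Sw0 : (0 < #|S :\ w|)%N.
  by rewrite -ltnS -cS (leq_ltn_trans _ SN) // /N'; lia.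
have SwR0 : 0 < #|S :\ w|%:R :> R by rewrite ltr0n.
(* Deleting w costs exactly g/|S| in the harmonic term, less than the gain in q/|S|. *)
have := Smax _ Sw0; apply/negP; rewrite -ltNge.
rewrite /psi cS /h /series /= big_nat_recr //= mulrDr addrCA addrC ltrD2r -cS.
rewrite -/g -mulrDl.
rewrite ltr_pdivrMr // mulrAC ltr_pdivlMr // mulrC [ltRHS]mulrC.
by move: wgain; rewrite -/g {1}cS -natr1 addrK.
Qed.

(** * The upper bound *)

Lemma q_radius_upper (R : realType) (F : sgraph) (r : nat) (e : R) :
  (2 <= r)%N -> colorable F r.+1 -> 0 < e -> e <= 1 ->
  exists M, forall G : sgraph, (M <= #|G|)%N -> F_free F G ->
    q_radius R G < (2 * (1 - r%:R^-1) + e) * #|G|%:R.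
Proof.
move=> r2 Fr e0 e1.
(* This makes 1/m < e/4, so that the degree excess e/4 covers the 1/(rm) required by the
   multipartite lemma. *)
pose m := (Num.truncn (4 / e)).+1.
have me : 4 < e * m%:R by rewrite -ltr_pdivrMl // mulrC truncnS_gt.
have [N NP] := @min_degree_multipartite m r #|F| isT.
have r0 : 0 < r%:R :> R by rewrite ltr0n (leq_trans _ r2).
(* From r >= 2 the threshold 2(1 - 1/r) + e is at least 1 + e, as the deletion argument requires. *)
have ri : r%:R^-1 <= 2^-1 :> R.
  by rewrite lef_pV2 ?posrE ?ltr0n ?ler_nat // (leq_trans _ r2).
have [|M MP] := @exists_large_min_degree R (2 * (1 - r%:R^-1) + e) e N e0 e1.
  by lra.
exists M => G MG GF; rewrite ltNge; apply/negP => /(MP _ MG)[S [SN Sdeg]].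
apply: GF; have [||B Bm] := NP (induced_subgraph S).
- by rewrite card_induced.
- move=> u; have := Sdeg _ (valP u); rewrite -degree_induced.
  have cE : (#|S| = degree u + codegree u)%N.
    rewrite -card_induced -cardsT -(cardsID [set v | adj u v]%SET) finset.setTI.
    congr addn; apply: eq_card => v; by rewrite !inE andbT.
  rewrite card_induced -(ler_nat R) natrD !natrM => ud.
  have : (codegree u)%:R < (r%:R^-1 - e / 4) * #|S|%:R :> R.
    by move: ud; rewrite cE natrD; lra.
  rewrite -(ltr_pM2l r0) mulrA mulrBr divff ?gt_eqF // => rc.
  have m0 : 0 <= m%:R :> R by [].
  have := ler_wpM2l m0 (ltW rc) => rcm.
  have S0 : 0 <= #|S|%:R :> R by [].
  have r1 : 1 <= r%:R :> R by rewrite ler1n ltnW.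
  have k1 : 4 * #|S|%:R <= e * m%:R * #|S|%:R by apply: ler_wpM2r (ltW me).
  have em0 : 0 <= e * m%:R * #|S|%:R by rewrite !mulr_ge0 // ltW.
  have := ler_wpM2r em0 r1.
  by lra.
have [f [finj fadj]] := contains_copy_multipartite Fr Bm.
exists (fun x => val (f x)); split => [x y /val_inj/finj //|x y /fadj].
by [].
Qed.

(** * The lower bound from Turan graphs *)

Definition turan_graph (n r : nat) : sgraph :=
  @SGraph 'I_n (fun i j => (i %% r != j %% r)%N)
    (fun i j => congr1 negb (eq_sym _ _)) (fun i => congr1 negb (eqxx _)).

Lemma turan_graph_F_free (F : sgraph) (n r : nat) :
  (0 < r)%N -> ~~ colorable F r -> F_free F (turan_graph n r).
Proof.
move=> r0 /negP Fr [f [_ fadj]]; apply: Fr; apply/existsP.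
exists [ffun x => Ordinal (ltn_pmod (f x : 'I_n) r0)].
apply/forallP => x; apply/forallP => y; apply/implyP => /fadj.
by rewrite !ffunE -val_eqE.
Qed.

(** Vertices of one residue class are told apart by their quotients by r, which are at most the
    integer part of n/r. *)
Lemma turan_graph_codegree (n r : nat) (i : turan_graph n r) :
  (0 < r)%N -> (codegree i <= (n %/ r).+1)%N.
Proof.
move=> r0.
have quo_lt (j : turan_graph n r) : ((j : 'I_n) %/ r < (n %/ r).+1)%N.
  by rewrite ltnS leq_div2r // ltnW.
pose quo j := Ordinal (quo_lt j).
rewrite -[leqRHS]card_ord /codegree -(card_in_imset (f := quo)).
  exact: max_card.
move=> j k; rewrite !inE !negbK => /eqP ij /eqP ik [jk].
apply/val_inj; rewrite /= (divn_eq (j : 'I_n) r) (divn_eq (k : 'I_n) r).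
by rewrite jk -ij ik.
Qed.

(** The Rayleigh quotient of the all-ones vector is twice the average degree, and every degree is at
    least n - n/r - 1. *)
Lemma q_radius_turan_graph (R : realType) (n r : nat) :
  (0 < n)%N -> (0 < r)%N ->
  2 * (1 - r%:R^-1) * n%:R - 2 <= q_radius R (turan_graph n r).
Proof.
move=> n0 r0; have G0 : (0 < #|turan_graph n r|)%N by rewrite card_ord.
have n0R : 0 < n%:R :> R by rewrite ltr0n.
have r0R : 0 < r%:R :> R by rewrite ltr0n.
have := q_rayleigh (fun=> 1 : R) G0.
have -> : \sum_(u : turan_graph n r) (1 : R) ^+ 2 = n%:R.
  by rewrite sumr_const card_ord expr1n.
move=> rayleigh; rewrite -(ler_pM2r n0R); apply: le_trans rayleigh.
set c := leLHS; have -> : c = \sum_(u : turan_graph n r)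
    (2 * (1 - r%:R^-1) * n%:R - 2).
  by rewrite sumr_const card_ord -[RHS]mulr_natr.
apply: ler_sum => u _; rewrite sumr_const mul1r.
have dE : (n = #|[pred v | adj u v]| + codegree u)%N.
  rewrite -{1}[n]card_ord -(cardC [pred v | adj u v]); congr addn.
  by apply: eq_card => v; rewrite !inE.
have cR : (codegree u)%:R <= n%:R / r%:R + 1 :> R.
  apply: le_trans (_ : (n %/ r).+1%:R <= _).
    by rewrite ler_nat turan_graph_codegree.
  by rewrite -natr1 lerD2r ler_pdivlMr // -natrM ler_nat leq_trunc_div.
have dR : n%:R = #|[pred v | adj u v]|%:R + (codegree u)%:R :> R.
  by rewrite -natrD -dE.
rewrite -mulr_natr; set D := _%:R in dR *; lra.
Qed.

(** * The asymptotic formula *)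

Theorem theorem1p4 (R : realType) (F : sgraph)
    (hF : (3 <= chromatic_number F)%N) :
  exists o : nat -> R,
    (o n @[n --> \oo] --> (0 : R)) /\
    forall n : nat, (0 < n)%N ->
      ex_q R n F =
        (1 - ((chromatic_number F)%:R - 1)^-1 + o n) * (2 * n%:R).
Proof.
have [r rE] : exists r, chromatic_number F = r.+1.
  by case: chromatic_number hF => // r; exists r.
have [Fr Fr1] : ~~ colorable F r /\ colorable F r.+1.
  move: rE; rewrite /chromatic_number; case: ex_minnP => k Fk kmin kr.
  split; last by rewrite -kr.
  by apply/negP => /kmin; rewrite kr ltnn.
have r2 : (2 <= r)%N by rewrite -ltnS -rE.
have r0 : (0 < r)%N by exact: ltnW.
have F2 : (2 <= chromatic_number F)%N by exact: ltnW.
rewrite rE -natr1 addrK.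
exists (fun n => ex_q R n F / (2 * n%:R) - (1 - r%:R^-1)); split; last first.
  move=> n n0; rewrite addrC subrK divfK // gt_eqF // mulr_gt0 // ltr0n //.
apply/cvgrPdist_lt => /= eps eps0.
pose e := Num.min eps 1.
have e0 : 0 < e by rewrite lt_min eps0 ltr01.
have e1 : e <= 1 by rewrite ge_min lexx orbT.
have ee : e <= eps by rewrite ge_min lexx.
have [M MP] := q_radius_upper r2 Fr1 e0 e1.
(* Ensures eps n > 1, so that the deficit 2 of the Turan bound is less than 2 eps n. *)
pose N := (Num.truncn (eps^-1)).+1.
exists (maxn M N) => // n; rewrite /= geq_max => /andP[Mn Nn].
have n0 : (0 < n)%N by exact: leq_trans Nn.
have n0R : 0 < n%:R :> R by rewrite ltr0n.
have epsn : 1 < eps * n%:R.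
  rewrite -ltr_pdivrMl // mulr1; apply: lt_le_trans (truncnS_gt _) _.
  by rewrite ler_nat.
have [[G [Gn GF ->]] ex_max] := ex_qP R n F2.
have hi : q_radius R G < (2 * (1 - r%:R^-1) + e) * n%:R.
  by rewrite -Gn; apply: MP; rewrite ?Gn.
have lo : 2 * (1 - r%:R^-1) * n%:R - 2 <= q_radius R G.
  apply: le_trans (q_radius_turan_graph R n0 r0) _.
  by apply: ex_max; [rewrite card_ord|exact: turan_graph_F_free].
set q := q_radius R G in hi lo *; set c := 1 - r%:R^-1 in hi lo *.
have -> : q / (2 * n%:R) - c = (q - 2 * c * n%:R) / (2 * n%:R).
  by field; rewrite gt_eqF.
rewrite sub0r normrN ltr_norml ltr_pdivlMr ?ltr_pdivrMr ?mulr_gt0 //.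
apply/andP; split; first by lra.
have := ler_wpM2r (ltW n0R) ee; have := mulr_gt0 eps0 n0R; lra.
Qed.
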